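(* Let $r \ge 1$, $k_1$, $k_2$ be integers with $2r < k_1$ and $2r<k_2$, and let $L(T_{k_1,k_2}^r)$ be the Laplacian matrix of the two-dimensional $r$-nearest neighbor torus $T_{k_1,k_2}^r$. Then the eigenvalues of $L(T_{k_1,k_2}^r)$, listed with multiplicity, are $$\lambda_{j_1,j_2}\left(L(T_{k_1,k_2}^r)\right) = 4r+2 - \frac{\sin\frac{(2r+1)\pi j_1}{k_1}}{\sin\frac{\pi j_1}{k_1}} - \frac{\sin\frac{(2r+1)\pi j_2}{k_2}}{\sin\frac{\pi j_2}{k_2}},$$ for $j_1 = 0,1,\dots,k_1-1$ and $j_2 = 0,1,\dots,k_2-1$, where for $j_i=0$ the corresponding quotient is read as its limiting value $2r+1$.
   Context: The $r$-nearest neighbor cycle $C_k^r$ (with $2r<k$) is the simple undirected graph on the vertex set $\mathbb{Z}/k\mathbb{Z}$ in which two distinct vertices are adjacent iff they differ by one of $\pm 1, \dots, \pm r$ modulo $k$. The two-dimensional $r$-nearest neighbor torus $T_{k_1,k_2}^r$ is the Cartesian (box) product of the graphs $C_{k_1}^r$ and $C_{k_2}^r$. The Laplacian matrix of a graph is $L = D - A$, where $A$ is the adjacency matrix and $D$ the diagonal matrix of vertex degrees. *)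

(* Defs.v *)
From HB Require Import structures.
From mathcomp Require Import all_boot all_order all_algebra.
From mathcomp Require Import all_classical all_reals all_analysis.

Set Implicit Arguments.
Unset Strict Implicit.
Unset Printing Implicit Defensive.

Import Order.TTheory GRing.Theory Num.Theory.

Local Open Scope ring_scope.

Record sgraph := SGraph {
  vertex : finType;
  adj : rel vertex;
  adj_sym : symmetric adj;
  adj_irr : irreflexive adj
}.

(* Matrices are indexed by 'I_#|V|; the i-th row and column belong to the
   vertex [enum_val i]. *)
Section Laplacian.
Variables (R : nzRingType) (G : sgraph).

Definition degree (x : vertex G) : nat := #|[pred y | adj x y]|.

Definition adjacency_mx : 'M[R]_#|vertex G| :=
  \matrix_(i, j) (adj (enum_val i) (enum_val j))%:R.

Definition degree_mx : 'M[R]_#|vertex G| :=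
  diag_mx (\row_i (degree (enum_val i))%:R).

Definition laplacian_mx : 'M[R]_#|vertex G| := degree_mx - adjacency_mx.

End Laplacian.

Section BoxProduct.
Variables G H : sgraph.

Definition box_rel : rel (vertex G * vertex H)%type := fun x y =>
  (x.1 == y.1) && adj x.2 y.2 || adj x.1 y.1 && (x.2 == y.2).

Lemma box_rel_sym : symmetric box_rel.
Proof.
by move=> x y; rewrite /box_rel (adj_sym x.1) (adj_sym x.2) ![_ == y.1]eq_sym ![_ == y.2]eq_sym.
Qed.

Lemma box_rel_irr : irreflexive box_rel.
Proof. by move=> x; rewrite /box_rel !adj_irr andbF. Qed.

Definition box_product : sgraph := SGraph box_rel_sym box_rel_irr.

End BoxProduct.

Section NearestNeighbor.
Variables r k : nat.

Definition nn_rel : rel 'Z_k := fun x y =>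
  (x != y) &&
  [exists d : 'I_r.+1,
     (0 < d)%N && ((y - x == d%:R) || (y - x == - d%:R))].

Lemma nn_rel_sym : symmetric nn_rel.
Proof.
move=> x y; rewrite /nn_rel eq_sym; congr (_ && _).
by apply: eq_existsb => d; rewrite -(opprB x y) eqr_opp eqr_oppLR orbC.
Qed.

Lemma nn_rel_irr : irreflexive nn_rel.
Proof. by move=> x; rewrite /nn_rel eqxx. Qed.

(* 'Z_k is the ring of integers modulo k only when 1 < k, which follows from
   0 < r and 2 * r < k. *)
Definition nn_cycle : sgraph := SGraph nn_rel_sym nn_rel_irr.

End NearestNeighbor.

Definition nn_torus (r k1 k2 : nat) : sgraph :=
  box_product (nn_cycle r k1) (nn_cycle r k2).

(* [s] lists the roots of the characteristic polynomial of [A], repeated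
   according to multiplicity, with no root missing. *)
Definition eigenvalues_with_multiplicity (R : comNzRingType) (n : nat)
    (A : 'M[R]_n) (s : seq R) : Prop :=
  char_poly A = \prod_(x <- s) ('X - x%:P).

(* For j = 0 both sines vanish, and the quotient stands for the limit
   (2 r + 1) of sin ((2 r + 1) t) / sin t as t tends to 0. *)
Definition sin_quotient (R : realType) (r k j : nat) : R :=
  if j == 0%N then (2 * r + 1)%:R
  else sin ((2 * r + 1)%:R * pi * j%:R / k%:R) / sin (pi * j%:R / k%:R).

(* Main.v *)
Require Import Defs.
From mathcomp Require Import all_boot all_order all_algebra.
From mathcomp Require Import all_classical all_reals all_analysis.
From mathcomp Require Import ring lra zify.

Import Order.TTheory GRing.Theory Num.Theory.

Local Open Scope ring_scope.

(** The torus carries a real orthogonal eigenbasis of the Laplacian made of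
products of one-dimensional waves, and the eigenvalues can be read off from it.

On the cycle of length [k] the waves are the Hartley functions
[x |-> cos (2 pi j x / k) + sin (2 pi j x / k)], one for each [j] in ['Z_k].
They replace the complex exponentials and keep everything over the reals:
- they are orthogonal with common squared norm [k] ([hartley_orthogonal]);
- adding the two shifts by [d] and [- d] multiplies such a function by
  [2 cos (2 pi j d / k)] ([hartley_symmetric_shift]).

The neighbours of [x] in the cycle are the [2 r] distinct points
[x + d] and [x - d] with [1 <= d <= r] ([sum_adj_nn_cycle]), so the Laplacian
has eigenvalue [2 r - \sum_(1 <= d <= r) 2 cos (2 pi j d / k)] on the [j]-th
wave, and Dirichlet's summation formula turns this into [2 r + 1] minus the
quotient of sines ([sin_quotientE], [nn_cycle_eigenbasis]).

The Laplacian of a box product acts as the sum of the Laplacians of the two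
factors, one in each coordinate, so products of eigenfunctions are
eigenfunctions for the sums of the eigenvalues ([eigenbasis_box]). An orthogonal
family of eigenfunctions with as many members as there are vertices makes the
Laplacian similar to a diagonal matrix, which gives the characteristic
polynomial and hence the multiplicities ([eigenbasis_char_poly]). *)

(** * Characteristic polynomial from an eigenbasis *)

(** Invertibility of [P] over the fraction field suffices: the relation
passes to [P ('X - B) = ('X - A) P], and [\det P] can be cancelled in the
integral domain of polynomials. *)
Lemma char_poly_similar (K : idomainType) (n : nat) (A B P : 'M[K]_n) :
  \det P != 0 -> A *m P = P *m B -> char_poly A = char_poly B.
Proof.
move=> detP AP.
have detPX : \det (map_mx polyC P) != 0 by rewrite det_map_mx polyC_eq0.
apply: (mulIf detPX); rewrite /char_poly -det_mulmx [RHS]mulrC -det_mulmx.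
congr (\det _); rewrite /char_poly_mx mulmxBl mulmxBr -!map_mxM AP.
by rewrite scalar_mxC.
Qed.

Section LaplacianEigenbasis.
Variable K : idomainType.

(** The vertices themselves index the family, so that it automatically has the
cardinality of a basis. The common squared norm [c] is kept as a parameter
because normalising the functions would require square roots. *)
Definition laplacian_eigenbasis (G : sgraph)
    (phi : vertex G -> vertex G -> K) (lam : vertex G -> K) (c : K) : Prop :=
  (forall a x : vertex G, \sum_(y | adj x y) (phi a x - phi a y) = lam a * phi a x) /\
  (forall a b, \sum_x phi a x * phi b x = if a == b then c else 0).

Lemma laplacian_mxE (G : sgraph) (f : vertex G -> K) (i : 'I_#|vertex G|) :
  \sum_j laplacian_mx K G i j * f (enum_val j) =
  \sum_(y | adj (enum_val i) y) (f (enum_val i) - f y).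
Proof.
under eq_bigr => j _ do rewrite !mxE mulrBl.
rewrite !sumrB; congr (_ - _).
  rewrite (bigD1 i) //= eqxx mulr1n big1 => [|j ne_ji]; last first.
    by rewrite eq_sym (negbTE ne_ji) mulr0n mul0r.
  by rewrite addr0 sumr_const mulr_natl.
rewrite -(big_enum_val (fun y => (adj (enum_val i) y)%:R * f y)) /=.
by rewrite [RHS]big_mkcond; apply: eq_bigr => y _; case: adj; rewrite (mul1r, mul0r).
Qed.

(** The matrix [P] whose columns are the eigenfunctions satisfies
[P^T *m P = c%:M], hence has nonzero determinant, and conjugates the Laplacian
to the diagonal matrix of the eigenvalues. *)
Lemma eigenbasis_char_poly (G : sgraph) phi lam c :
  @laplacian_eigenbasis G phi lam c -> c != 0 ->
  char_poly (laplacian_mx K G) = \prod_a ('X - (lam a)%:P).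
Proof.
move=> [eig orth] c_neq0.
pose P : 'M[K]_#|vertex G| := \matrix_(i, a) phi (enum_val a) (enum_val i).
pose D : 'M[K]_#|vertex G| := diag_mx (\row_a lam (enum_val a)).
have PTP : P^T *m P = c%:M.
  apply/matrixP => a b; rewrite !mxE.
  under eq_bigr => i _ do rewrite !mxE.
  rewrite -(big_enum_val (fun x => phi (enum_val a) x * phi (enum_val b) x)).
  by rewrite orth (inj_eq enum_val_inj) -mulrb.
have detP : \det P != 0.
  apply: contraNneq (expf_neq0 #|vertex G| c_neq0) => detP0.
  by rewrite -det_scalar -PTP det_mulmx detP0 mulr0.
have LP : laplacian_mx K G *m P = P *m D.
  apply/matrixP => i a; rewrite mul_mx_diag !mxE mulrC -eig -laplacian_mxE.
  by apply: eq_bigr => j _; rewrite !mxE.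
rewrite (char_poly_similar _ _ _ _ _ detP LP) char_poly_trig ?diag_mx_is_trig //.
rewrite [RHS](big_enum_val (fun a => 'X - (lam a)%:P)).
by apply: eq_bigr => i _; rewrite !mxE eqxx.
Qed.

(** * Box products *)

(** The neighbours of [(x, y)] split into those that move only the first
coordinate and those that move only the second one; on each part the other
factor of the product of functions is constant and comes out of the sum. *)
Lemma eigenbasis_box (G H : sgraph) phi lam c psi mu d :
  @laplacian_eigenbasis G phi lam c -> @laplacian_eigenbasis H psi mu d ->
  @laplacian_eigenbasis (box_product G H)
    (fun a x => phi a.1 x.1 * psi a.2 x.2) (fun a => lam a.1 + mu a.2) (c * d).
Proof.
move=> [eigG orthG] [eigH orthH]; split=> [[a b] [x y]|[a b] [a' b']] /=.
  rewrite (bigID (fun z : vertex G * vertex H => x == z.1)) /= addrC mulrDl.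
  congr (_ + _).
    transitivity (\sum_(z | adj x z) (phi a x - phi a z) * psi b y).
      have -> : \sum_(z | adj x z) (phi a x - phi a z) * psi b y =
         \sum_(z | adj x z) \sum_(w | w == y) (phi a x * psi b y - phi a z * psi b w).
        by apply: eq_bigr => z _; rewrite big_pred1_eq mulrBl.
      rewrite pair_big_dep /=; apply: eq_bigl => -[z w] /=.
      rewrite /box_rel /= [w == y]eq_sym.
      by case: eqVneq => [<-|_]; rewrite /= ?adj_irr ?andbF ?andbT.
    by rewrite -mulr_suml eigG -mulrA.
  transitivity (\sum_(w | adj y w) phi a x * (psi b y - psi b w)).
    have -> : \sum_(w | adj y w) phi a x * (psi b y - psi b w) =
       \sum_(z | z == x) \sum_(w | adj y w) (phi a x * psi b y - phi a z * psi b w).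
      by rewrite big_pred1_eq; apply: eq_bigr => w _; rewrite mulrBr.
    rewrite pair_big_dep /=; apply: eq_bigl => -[z w] /=.
    rewrite /box_rel /= [z == x]eq_sym.
    by case: eqVneq => [<-|_]; rewrite /= ?adj_irr ?andbF ?andbT ?orbF.
  by rewrite -mulr_sumr eigH mulrCA.
transitivity (\sum_x \sum_y (phi a x * phi a' x) * (psi b y * psi b' y)).
  by rewrite pair_big; apply: eq_bigr => -[x y] _ /=; rewrite mulrACA.
under eq_bigr => x _ do rewrite -mulr_sumr orthH.
rewrite -mulr_suml orthG xpair_eqE.
by do 2!case: eqP => _; rewrite /= ?mulr0 ?mul0r.
Qed.

End LaplacianEigenbasis.

(** * Neighbours in the cycle *)

(** The bound [2 * r < k] makes the [2 * r] residues [d] and [- d] with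
[1 <= d <= r] distinct and nonzero, so that each neighbour is counted once. *)
Lemma sum_adj_nn_cycle (V : nmodType) (r k : nat) (F : 'Z_k -> V) (x : 'Z_k) :
  (2 * r < k)%N ->
  \sum_(y | @adj (nn_cycle r k) x y) F y =
  \sum_(1 <= d < r.+1) (F (x + d%:R) + F (x - d%:R)).
Proof.
case: r => [|r] ltrk.
  rewrite big_nil big_pred0 // => y; apply/andP => -[_ /existsP[d]].
  by rewrite ltnNge -ltnS ltn_ord.
have k_gt1 : (1 < k)%N by lia.
set s := iota 1 r.+1.
have natZ d : d \in s -> ((d%:R : 'Z_k) = d :> nat) /\ ((- d%:R : 'Z_k) = (k - d)%N :> nat).
  rewrite mem_iota => ltd; rewrite /= val_Zp_nat // Zp_cast //.
  by rewrite ![(d %% k)%N]modn_small ?modn_small; lia.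
have uniq_s : uniq ([seq d%:R | d <- s] ++ [seq - d%:R | d <- s] : seq 'Z_k).
  have us : uniq s by exact: iota_uniq.
  rewrite cat_uniq; apply/and3P; split.
  - rewrite map_inj_in_uniq // => d e /natZ[eqd _] /natZ[eqe _].
    by move=> /(congr1 (@nat_of_ord _)); rewrite eqd eqe.
  - apply/hasPn => _ /mapP[d ds ->]; apply/mapP => -[e es].
    move=> /(congr1 (@nat_of_ord _)); rewrite (natZ d ds).2 (natZ e es).1.
    by move: ds es; rewrite !mem_iota; lia.
  - rewrite map_inj_in_uniq // => d e ds es.
    move=> /(congr1 (@nat_of_ord _)); rewrite (natZ d ds).2 (natZ e es).2.
    by move: ds es; rewrite !mem_iota; lia.
have adjE y : @adj (nn_cycle r.+1 k) x y =
    (y - x \in [seq d%:R | d <- s] ++ [seq - d%:R | d <- s]).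
  rewrite mem_cat; apply/andP/orP => [[_ /existsP[d /andP[d_gt0 eqd]]]|yx].
    have ds : val d \in s by rewrite mem_iota d_gt0 ltn_ord.
    by case/orP: eqd => /eqP->; [left | right]; apply/mapP; exists (val d).
  have {yx} [d ds yx] : exists2 d, d \in s & (y - x == d%:R) || (y - x == - d%:R).
    by case: yx => /mapP[d ds ->]; exists d; rewrite ?eqxx ?orbT.
  have [d_gt0 ltdr] : (0 < d)%N /\ (d < r.+2)%N.
    by move: ds; rewrite mem_iota => /andP[].
  split; last by apply/existsP; exists (Ordinal ltdr); rewrite d_gt0.
  apply: contraTneq yx => ->; rewrite subrr negb_or !(eq_sym 0).
  rewrite oppr_eq0 andbb; apply/eqP => /(congr1 (@nat_of_ord _)).
  by rewrite (natZ d ds).1 /=; lia.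
rewrite (eq_bigl _ _ adjE) (reindex_inj (addrI x)) /=.
transitivity (\sum_(z in [seq d%:R | d <- s] ++ [seq - d%:R | d <- s]) F (x + z)).
  by apply: eq_bigl => z; rewrite addrAC subrr add0r.
rewrite -big_uniq // big_cat !big_map /= -big_split /=.
by rewrite /index_iota subn1.
Qed.

(** * Trigonometric functions on the integers modulo k *)

Section HartleyBasis.
Variables (R : realType) (k : nat).
Hypothesis k_gt1 : (1 < k)%N.

Definition angle (n : nat) : R := pi *+ 2 * n%:R / k%:R.

Lemma angle_half n : angle n = (pi * n%:R / k%:R) *+ 2.
Proof.
(* [pi] is itself defined as a double, which rewriting would see; hence the
   generalisation. *)
by rewrite /angle; move: pi => p; rewrite !mulrnAl.
Qed.

Lemma angleD m n : angle (m + n)%N = angle m + angle n.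
Proof. by rewrite /angle natrD mulrDr mulrDl. Qed.

(** Reducing [n] modulo [k] changes its angle by full turns only, which makes
the trigonometric functions below additive in the ring ['Z_k]. *)
Lemma angle_mod n : angle n = angle (n %% k) + pi *+ 2 *+ (n %/ k).
Proof.
rewrite {1}(divn_eq n k) addnC angleD; congr (_ + _).
rewrite /angle natrM mulrA mulfK; first by rewrite mulr_natr.
by rewrite pnatr_eq0; lia.
Qed.

Definition cosZ (z : 'Z_k) : R := cos (angle z).
Definition sinZ (z : 'Z_k) : R := sin (angle z).

Lemma cosZ_nat n : cosZ n%:R = cos (angle n).
Proof.
by rewrite /cosZ val_Zp_nat // (angle_mod n) (periodicn (@cosD2pi R)).
Qed.

Lemma sinZ_nat n : sinZ n%:R = sin (angle n).
Proof.
by rewrite /sinZ val_Zp_nat // (angle_mod n) (periodicn (@sinD2pi R)).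
Qed.

Lemma cosZD x y : cosZ (x + y) = cosZ x * cosZ y - sinZ x * sinZ y.
Proof.
by rewrite -{1}[x]natr_Zp -{1}[y]natr_Zp -natrD cosZ_nat angleD cosD.
Qed.

Lemma sinZD x y : sinZ (x + y) = sinZ x * cosZ y + cosZ x * sinZ y.
Proof.
by rewrite -{1}[x]natr_Zp -{1}[y]natr_Zp -natrD sinZ_nat angleD sinD.
Qed.

Lemma cosZ0 : cosZ 0 = 1.
Proof. by rewrite (cosZ_nat 0) /angle mulr0 mul0r cos0. Qed.

Lemma sinZ0 : sinZ 0 = 0.
Proof. by rewrite (sinZ_nat 0) /angle mulr0 mul0r sin0. Qed.

Lemma cos2Dsin2Z x : cosZ x ^+ 2 + sinZ x ^+ 2 = 1.
Proof. exact: cos2Dsin2. Qed.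

(** The addition formulas at [x + - x = 0] form a linear system for the cosine
and sine of [- x], with determinant [cosZ x ^+ 2 + sinZ x ^+ 2 = 1]. *)
Lemma trigZN x : cosZ (- x) = cosZ x /\ sinZ (- x) = - sinZ x.
Proof.
have c := cosZD x (- x); have s := sinZD x (- x).
rewrite subrr cosZ0 in c; rewrite subrr sinZ0 in s.
have e := cos2Dsin2Z x; set a := cosZ x in c s e *; set b := sinZ x in c s e *.
set a' := cosZ _ in c s *; set b' := sinZ _ in c s *.
split.
- have -> : a' = a' * (a ^+ 2 + b ^+ 2) by rewrite e mulr1.
  by transitivity (a * (a * a' - b * b') + b * (b * a' + a * b')); [ring | rewrite -c -s; ring].
- have -> : b' = b' * (a ^+ 2 + b ^+ 2) by rewrite e mulr1.
  by transitivity (a * (b * a' + a * b') - b * (a * a' - b * b')); [ring | rewrite -c -s; ring].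
Qed.

Lemma sin_half_angle_gt0 j : (0 < j < k)%N -> 0 < sin (pi * j%:R / k%:R : R).
Proof.
move=> /andP[j_gt0 ltjk]; have k_gt0 : 0 < k%:R :> R by rewrite ltr0n; lia.
apply: sin_gt0_pi; apply/andP; split.
  by rewrite divr_gt0 ?mulr_gt0 ?pi_gt0 ?k_gt0 ?ltr0n.
by rewrite ltr_pdivrMr // ltr_pM2l ?pi_gt0 // ltr_nat.
Qed.

(** By the half-angle formula [1 - cosZ z = 2 * sin (pi * z / k) ^+ 2], and the
half angle lies strictly between [0] and [pi]. *)
Lemma cosZ_neq1 z : z != 0 -> cosZ z != 1.
Proof.
move=> z_neq0; have ltzk : (z < k)%N by rewrite -[leqRHS](Zp_cast k_gt1).
have := @sin_half_angle_gt0 z; rewrite ltzk lt0n z_neq0 => /(_ isT) s_gt0.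
rewrite -subr_eq0 /cosZ angle_half cos_mulr2n cos2sin2.
set s := sin _ in s_gt0 *.
have -> : (1 - s ^+ 2) *+ 2 - 1 - 1 = - 2 * s ^+ 2 by ring.
by rewrite mulf_neq0 ?oppr_eq0 ?pnatr_eq0 // expf_neq0 ?gt_eqF.
Qed.

(** The summand is odd and [x |-> - x] permutes ['Z_k]. *)
Lemma sum_sinZ m : \sum_(x : 'Z_k) sinZ (m * x) = 0.
Proof.
have: \sum_(x : 'Z_k) sinZ (m * x) = - \sum_(x : 'Z_k) sinZ (m * x).
  rewrite {1}(reindex_inj (@oppr_inj _)) /= -sumrN; apply: eq_bigr => x _.
  by rewrite mulrN (trigZN _).2.
by move=> sumN; lra.
Qed.

(** Translating [x] by [1] permutes ['Z_k]; since the sines sum to zero, it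
multiplies the sum by [cosZ m], and [cosZ m != 1] unless [m = 0]. *)
Lemma sum_cosZ m : \sum_(x : 'Z_k) cosZ (m * x) = if m == 0 then k%:R else 0.
Proof.
have [->|m_neq0] := eqVneq.
  under eq_bigr => x _ do rewrite mul0r cosZ0.
  by rewrite sumr_const card_ord Zp_cast.
set S := \sum_x _.
have : S = cosZ m * S - sinZ m * \sum_(x : 'Z_k) sinZ (m * x).
  rewrite {1}/S (reindex_inj (addrI 1)) /= !mulr_sumr -sumrB.
  by apply: eq_bigr => x _; rewrite mulrDr mulr1 cosZD.
rewrite sum_sinZ mulr0 subr0 => fixS.
apply: (mulIf (_ : 1 - cosZ m != 0)); last by rewrite mul0r; lra.
by rewrite subr_eq0 eq_sym cosZ_neq1.
Qed.

(** * The Hartley eigenbasis of the cycle *)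

(** The kernel of the discrete Hartley transform, a real-valued substitute for
the characters of ['Z_k]. *)
Definition hartley (j x : 'Z_k) : R := cosZ (j * x) + sinZ (j * x).

(** A product of two kernels is [cosZ ((i - j) * x) + sinZ ((i + j) * x)]:
the sines sum to zero, and the cosines do unless [i = j]. *)
Lemma hartley_orthogonal i j :
  \sum_(x : 'Z_k) hartley i x * hartley j x = if i == j then k%:R else 0.
Proof.
rewrite -subr_eq0 -sum_cosZ -[LHS]subr0 -[X in _ - X](sum_sinZ (i + j)) -sumrB.
apply: eq_bigr => x _; rewrite /hartley mulrBl (mulrDl i j x) cosZD sinZD.
by rewrite (trigZN _).1 (trigZN _).2; ring.
Qed.

(** Symmetrising the shift cancels the term in which cosine and sine are
exchanged; this is why the neighbourhoods, being symmetric, act diagonally. *)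
Lemma hartley_symmetric_shift j x d :
  hartley j (x + d) + hartley j (x - d) = 2 * cosZ (j * d) * hartley j x.
Proof.
rewrite /hartley !mulrDr !cosZD !sinZD mulrN (trigZN _).1 (trigZN _).2.
by ring.
Qed.

(** The sum telescopes:
[2 * sin t * cos (2 d t) = sin ((2 d + 1) t) - sin ((2 d - 1) t)]. *)
Lemma dirichlet_kernel r (t : R) :
  sin t * (1 + \sum_(1 <= d < r.+1) 2 * cos (t *+ 2 * d%:R)) =
  sin ((2 * r + 1)%:R * t).
Proof.
elim: r => [|r IHr]; first by rewrite big_nil addr0 mulr1 mul1r.
rewrite big_nat_recr //= addrA mulrDr IHr.
set u := t *+ 2 * r.+1%:R.
have -> : (2 * r + 1)%:R * t = u - t.
  by rewrite /u natrD natrM; ring.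
have -> : (2 * r.+1 + 1)%:R * t = u + t by rewrite /u natrD natrM; ring.
by rewrite sinB sinD; ring.
Qed.

(** For [j = 0] every cosine is [1], and the sum gives the limiting value. *)
Lemma sin_quotientE r (j : 'Z_k) :
  sin_quotient R r k j = 1 + \sum_(1 <= d < r.+1) 2 * cosZ (j * d%:R).
Proof.
rewrite /sin_quotient; case: ifP => [j_eq0|j_neq0].
  have -> : j = 0 by exact/eqP.
  under eq_bigr => d _ do rewrite mul0r cosZ0 mulr1.
  by rewrite sumr_const_nat subn1 natrD natrM addrC mulr_natr.
have ltjk : (j < k)%N by rewrite -[leqRHS](Zp_cast k_gt1).
have := @sin_half_angle_gt0 j; rewrite ltjk lt0n j_neq0 => /(_ isT) s_gt0.
rewrite -(mulrA _ pi) -(mulrA _ (pi * _)) -dirichlet_kernel.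
rewrite [LHS]mulrAC divff ?gt_eqF // mul1r.
congr (1 + _); apply: eq_bigr => d _; congr (2 * _).
rewrite -[j in RHS]natr_Zp -natrM cosZ_nat angle_half natrM; congr cos.
by move: pi => p; rewrite [LHS]mulrnAl; congr (_ *+ 2); ring.
Qed.

Lemma nn_cycle_eigenbasis r : (2 * r < k)%N ->
  @laplacian_eigenbasis R (nn_cycle r k) hartley
    (fun j => (2 * r + 1)%:R - sin_quotient R r k j) k%:R.
Proof.
move=> ltrk; split=> [j x|]; last exact: hartley_orthogonal.
rewrite (sum_adj_nn_cycle R r k (fun y => hartley j x - hartley j y)) //.
have -> : (2 * r + 1)%:R - sin_quotient R r k j =
    \sum_(1 <= d < r.+1) (2 - 2 * cosZ (j * d%:R)).
  rewrite sumrB sin_quotientE sumr_const_nat subn1 natrD natrM /=.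
  by ring.
rewrite mulr_suml; apply: eq_bigr => d _.
by rewrite mulrBl -hartley_symmetric_shift; ring.
Qed.

End HartleyBasis.

(** * The torus *)

Theorem theorem4 (R : realType) (r k1 k2 : nat)
  (hr : (1 <= r)%N) (hk1 : (2 * r < k1)%N) (hk2 : (2 * r < k2)%N) :
  eigenvalues_with_multiplicity (laplacian_mx R (nn_torus r k1 k2))
    [seq (4 * r + 2)%:R - sin_quotient R r k1 j1 - sin_quotient R r k2 j2
       | j1 <- iota 0 k1, j2 <- iota 0 k2].
Proof.
have k1_gt1 : (1 < k1)%N by lia.
have k2_gt1 : (1 < k2)%N by lia.
have prodZ k (F : nat -> {poly R}) : (1 < k)%N ->
    \prod_(j <- iota 0 k) F j = \prod_(j : 'Z_k) F j.
  by move=> k_gt1; rewrite -(big_mkord xpredT) Zp_cast // /index_iota subn0.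
have basis := eigenbasis_box R _ _ _ _ _ _ _ _
  (nn_cycle_eigenbasis R k1 k1_gt1 r hk1) (nn_cycle_eigenbasis R k2 k2_gt1 r hk2).
rewrite /eigenvalues_with_multiplicity (eigenbasis_char_poly R _ _ _ _ basis).
  rewrite big_allpairs_dep prodZ //.
  under [RHS]eq_bigr => j1 _ do rewrite prodZ //.
  rewrite pair_big /=; apply: eq_bigr => -[j1 j2] _ /=; congr ('X - _%:P).
  have -> : (4 * r + 2 = (2 * r + 1) + (2 * r + 1))%N by lia.
  by rewrite (natrD _ (2 * r + 1)); ring.
by rewrite -natrM pnatr_eq0; lia.
Qed.
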